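(* Let $\mathbb{X},\mathbb{Y}$ be two-dimensional real Banach spaces. Let $T\in\mathbb{L}(\mathbb{X},\mathbb{Y})$ be such that $\|T\|=1$ and $|M_T\cap \mathrm{Ext}(B_{\mathbb{X}})|\ge 8$. Then the following hold: (i) If $Tx$ is not smooth for some $x\in M_T\cap \mathrm{Ext}(B_{\mathbb{X}})$, then $T$ is $4$-smooth. (ii) Suppose $Tx$ is smooth for each $x\in M_T\cap \mathrm{Ext}(B_{\mathbb{X}})$. If there exist $x_i\in M_T\cap \mathrm{Ext}(B_{\mathbb{X}})$ and $y_i^*\in J(Tx_i)$ for $i=1,2,3,4$ such that $$x_2=ax_1+bx_3,\quad x_4=cx_1+dx_3,\quad y_2^*=\alpha_1y_1^*+\alpha_2y_3^*,\quad y_4^*=\beta_1y_1^*+\beta_2y_3^*$$ (with $a,b,c,d,\alpha_1,\alpha_2,\beta_1,\beta_2$ real) and $\beta_1\alpha_2ad-\beta_2\alpha_1bc\ne 0$, then $T$ is $4$-smooth. Otherwise $T$ is $3$-smooth.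
   Context: All Banach spaces are real. $|A|$ denotes the cardinality of a set $A$. For a Banach space $\mathbb{X}$, $B_{\mathbb{X}}=\{x:\|x\|\le 1\}$, $S_{\mathbb{X}}=\{x:\|x\|=1\}$, $\mathbb{X}^*$ is the dual space, and $\mathrm{Ext}(B_{\mathbb{X}})$ is the set of extreme points of $B_{\mathbb{X}}$. $\mathbb{L}(\mathbb{X},\mathbb{Y})$ is the space of bounded linear operators with the operator norm. For $x\in S_{\mathbb{X}}$, $J(x)=\{x^*\in S_{\mathbb{X}^*}: x^*(x)=1\}$. A vector $x\in S_{\mathbb{X}}$ is smooth if $J(x)$ is a singleton, and is $k$-smooth if $\dim\operatorname{span}J(x)=k$. An operator $T\in \mathbb{L}(\mathbb{X},\mathbb{Y})$ with $\|T\|=1$ is $k$-smooth if it is $k$-smooth as an element of the unit sphere of the Banach space $\mathbb{L}(\mathbb{X},\mathbb{Y})$, i.e. $\dim\operatorname{span}J(T)=k$ with $J(T)=\{f\in S_{\mathbb{L}(\mathbb{X},\mathbb{Y})^*}: f(T)=1\}$. The norm attainment set of $T$ is $M_T=\{x\in S_{\mathbb{X}}:\|Tx\|=\|T\|\}$.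
   Formalization: In (ii) the four points x_1, x_2, x_3, x_4 are required to be pairwise distinct; if repetitions were allowed the condition would always hold, and the claim fails for the identity of the Euclidean plane, which is 3-smooth. *)

(* Defs.v *)
From HB Require Import structures.
From mathcomp Require Import all_boot all_order all_algebra.
From mathcomp Require Import all_classical all_reals all_analysis.

Set Implicit Arguments.
Unset Strict Implicit.
Unset Printing Implicit Defensive.

Import Order.TTheory GRing.Theory Num.Theory.
Import numFieldNormedType.Exports.

Local Open Scope classical_set_scope.
Local Open Scope ring_scope.

Section linear_algebra.
Context {R : realType} {V : lmodType R}.

Definition lin_span (A : set V) : set V :=
  [set v | exists n (c : 'I_n -> R) (u : 'I_n -> V),
     (forall i, A (u i)) /\ v = \sum_i c i *: u i].

Definition lin_indep n (b : 'I_n -> V) : Prop :=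
  forall c : 'I_n -> R, \sum_i c i *: b i = 0 -> forall i, c i = 0.

(* The set W is a linear subspace of dimension n: it is exactly the set of
   linear combinations of n linearly independent vectors. *)
Definition has_dim (W : set V) (n : nat) : Prop :=
  exists b : 'I_n -> V, lin_indep b /\
    W = [set v | exists c : 'I_n -> R, v = \sum_i c i *: b i].

Definition extreme_points (A : set V) : set V :=
  [set x | A x /\ forall (y z : V) (t : R), A y -> A z -> 0 < t < 1 ->
     x = t *: y + (1 - t) *: z -> y = z].

End linear_algebra.

Definition unit_ball {R : realType} (V : normedModType R) : set V :=
  [set x | `|x| <= 1].
Arguments unit_ball {R} V.

Section bounded_operators.
Context {R : realType} (X Y : normedModType R).

Definition bounded_linear : {pred X -> Y} :=
  mem [set f : X -> Y | linear f /\ exists M : R, forall x, `|f x| <= M * `|x|].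

Record bop := BOp { bop_fun :> X -> Y; bop_mem : bop_fun \in bounded_linear }.

HB.instance Definition _ := [isSub for bop_fun].
HB.instance Definition _ := [Choice of bop by <:].

Lemma bopP (T : bop) :
  linear T /\ exists M : R, forall x, `|T x| <= M * `|x|.
Proof. by case: T => f /= /set_mem. Qed.

Lemma bounded_linear_submod_closed : submod_closed bounded_linear.
Proof.
split.
  apply/mem_set; split => [a x y|]; first by rewrite /= scaler0 addr0.
  by exists 0 => x; rewrite mul0r normr0.
move=> a f g /set_mem[lf [M Mf]] /set_mem[lg [N Ng]]; apply/mem_set; split.
  move=> k x y; rewrite !fctE lf lg !scalerDr !scalerA (mulrC a k) -!addrA.
  by congr (_ + _); rewrite addrCA.
exists (`|a| * M + N) => x; rewrite !fctE (le_trans (ler_normD _ _))//.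
by rewrite mulrDl lerD// normrZ -mulrA ler_wpM2l.
Qed.

HB.instance Definition _ := GRing.isSubmodClosed.Build R (X -> Y)
  bounded_linear bounded_linear_submod_closed.

HB.instance Definition _ := [SubChoice_isSubLmodule of bop by <:].

HB.instance Definition _ (T : bop) :=
  GRing.isLinear.Build R X Y _ (bop_fun T) (proj1 (bopP T)).

Definition opnorm (T : bop) : R := sup [set `|T x| | x in unit_ball X].

Lemma opnorm_has_sup (T : bop) : has_sup [set `|T x| | x in unit_ball X].
Proof.
split; first by exists `|T 0|, 0 => //=; rewrite /unit_ball/= normr0.
have [_ [M TM]] := bopP T; exists `|M| => _ [x /= x1 <-].
rewrite (le_trans (TM x))// (le_trans (ler_wpM2r _ (ler_norm M)))//.
by rewrite ler_piMr.
Qed.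

Lemma opnorm_ub (T : bop) x : `|x| <= 1 -> `|T x| <= opnorm T.
Proof.
by move=> x1; apply: (ub_le_sup (opnorm_has_sup T).2); exists x.
Qed.

Lemma opnorm_le (T : bop) (c : R) :
  (forall x, `|x| <= 1 -> `|T x| <= c) -> opnorm T <= c.
Proof.
move=> Tc; apply: ge_sup; first exact: (opnorm_has_sup T).1.
by move=> _ [x x1 <-]; exact: Tc.
Qed.

Lemma opnorm_ge0 (T : bop) : 0 <= opnorm T.
Proof. by rewrite (le_trans _ (@opnorm_ub T 0 _))// normr0. Qed.

Lemma opnormD (S T : bop) : opnorm (S + T) <= opnorm S + opnorm T.
Proof.
apply: opnorm_le => x x1.
by rewrite (le_trans (ler_normD (S x) (T x)))// lerD// opnorm_ub.
Qed.

Lemma opnormZ (a : R) (T : bop) : opnorm (a *: T) = `|a| * opnorm T.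
Proof.
have le_opnormZ b S : opnorm (b *: S) <= `|b| * opnorm S.
  apply: opnorm_le => x x1; rewrite [leLHS](normrZ b (S x)).
  by rewrite ler_wpM2l// opnorm_ub.
apply/eqP; rewrite eq_le le_opnormZ/=.
have [->|a0] := eqVneq a 0; first by rewrite normr0 mul0r opnorm_ge0.
rewrite -ler_pdivlMl ?normr_gt0// -normfV.
by rewrite -{1}[T](scalerK a0) le_opnormZ.
Qed.

Lemma opnorm0_eq0 (T : bop) : opnorm T = 0 -> T = 0.
Proof.
move=> T0; apply/val_inj/funext => x /=.
have [->|x0] := eqVneq x 0; first by rewrite linear0.
have : `|T (`|x|^-1 *: x)| <= 0.
  by rewrite -T0 opnorm_ub// normrZ normfV normr_id mulVf ?normr_eq0.
rewrite normr_le0 linearZ/= scaler_eq0 invr_eq0 normr_eq0 (negPf x0)/=.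
by move/eqP.
Qed.

HB.instance Definition _ :=
  @Lmodule_isNormed.Build R bop opnorm opnormD opnormZ opnorm0_eq0.

Definition norm_attainment (T : bop) : set X :=
  [set x | `|x| = 1 /\ `|T x| = `|T| ].

End bounded_operators.

Section smoothness.
Context {R : realType} {V : normedModType R}.

(* The dual space of V is [bop V R^o], where R^o is the scalar field seen as a
   normed space over itself. *)
Definition supp_funs (x : V) : set (bop V R^o) :=
  [set f : bop V R^o | `|f| = 1 /\ f x = 1].

Definition smooth (x : V) : Prop :=
  `|x| = 1 /\ exists f, supp_funs x = [set f].

Definition k_smooth (k : nat) (x : V) : Prop :=
  `|x| = 1 /\ has_dim (lin_span (supp_funs x)) k.

End smoothness.

(* The four vectors are required to be distinct: the hypothesis would otherwise
   be void, since x1 = x2 = x3 = x4, y1 = y2 = y3 = y4, (a, b) = (1, 0),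
   (c, d) = (0, 1), (alpha1, alpha2) = (0, 1), (beta1, beta2) = (1, 0) satisfies
   all the other requirements for any x1 in M_T and y1 in J(T x1). *)
Definition independence_condition {R : realType} (X Y : normedModType R)
    (T : bop X Y) : Prop :=
  exists (x1 x2 x3 x4 : X) (y1 y2 y3 y4 : bop Y R^o)
         (a b c d alpha1 alpha2 beta1 beta2 : R),
    let E := norm_attainment T `&` extreme_points (unit_ball X) in
    [/\ uniq [:: x1; x2; x3; x4],
        [/\ E x1, E x2, E x3 & E x4],
        [/\ supp_funs (T x1) y1, supp_funs (T x2) y2,
            supp_funs (T x3) y3 & supp_funs (T x4) y4],
        [/\ x2 = a *: x1 + b *: x3, x4 = c *: x1 + d *: x3,
            y2 = alpha1 *: y1 + alpha2 *: y3 & y4 = beta1 *: y1 + beta2 *: y3] &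
        beta1 * alpha2 * a * d - beta2 * alpha1 * b * c != 0].

(* Main.v *)
(* Let N be the space of operators S with y (S x) = 0 for all x in M_T and all
   y in J(T x). The right derivative at 0 of t |-> |T + t S| is the maximum of
   y (S x) over such x and y (the unit balls of X and of the
   dual of Y are compact), so N is the annihilator of J(T) and T is k-smooth iff
   dim N = 4 - k. In the plane, every x in M_T lies between two extreme points
   of M_T with the same y, hence x may be restricted to M_T /\ Ext(B_X) in the
   definition of N. A functional y o T equals 1 at no more than two extreme
   points, so the eight points provide x1, x3 and y1, y3 that are linearly
   independent. Then S in N is determined by p = y3 (S x1) and q = y1 (S x3),
   and a further pair x2 = a x1 + b x3, y2 = al1 y1 + al2 y3 imposes the single
   equation al2 a p + al1 b q = 0. The quantity in the independence condition
   is the determinant of two such equations. *)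

Require Import Defs.
From HB Require Import structures.
From mathcomp Require Import all_boot all_order all_algebra.
From mathcomp Require Import all_classical all_reals all_analysis.
From mathcomp Require Import ring lra.

Set Implicit Arguments.
Unset Strict Implicit.
Unset Printing Implicit Defensive.

Import Order.TTheory GRing.Theory Num.Theory.
Import numFieldNormedType.Exports.

Local Open Scope classical_set_scope.
Local Open Scope ring_scope.

(** * Bases and coordinates *)

Section bases.
Context {R : realType} {V : lmodType R}.
Implicit Types n : nat.

Definition lin_basis n (b : 'I_n -> V) : Prop :=
  lin_indep b /\ forall v, exists c : 'I_n -> R, v = \sum_i c i *: b i.

Lemma has_dimTP n :
  has_dim [set: V] n <-> exists b : 'I_n -> V, lin_basis b.
Proof.
split=> [[b [bI bT]]|[b [bI bT]]]; exists b; split=> //.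
  by move=> v; have : [set: V] v by []; rewrite bT.
by apply/esym/seteqP; split=> // v _; exact: bT.
Qed.

Lemma lin_indep_inj n (b : 'I_n -> V) (c c' : 'I_n -> R) : lin_indep b ->
  \sum_i c i *: b i = \sum_i c' i *: b i -> c =1 c'.
Proof.
move=> bI /eqP; rewrite -subr_eq0 -sumrB => /eqP cc' i; apply/eqP.
rewrite -subr_eq0; apply/eqP; apply: (bI (fun i => c i - c' i)).
by rewrite -[RHS]cc'; apply: eq_bigr => j _; rewrite scalerBl.
Qed.

(** Coordinates are picked by choice; their uniqueness, [lin_indep_inj], makes the resulting map
    linear. *)
Lemma lin_basis_coord n (b : 'I_n -> V) : lin_basis b ->
  exists phi : {linear V -> 'rV[R]_n},
    forall v, v = \sum_i phi v ord0 i *: b i.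
Proof.
move=> [bI bT]; pose f v : 'rV[R]_n := \row_i sval (cid (bT v)) i.
have fE v : v = \sum_i f v ord0 i *: b i.
  rewrite {1}(svalP (cid (bT v))).
  by apply: eq_bigr => i _; rewrite mxE.
have lf : linear f.
  move=> a u v; apply/rowP => i; rewrite [RHS]mxE [in RHS]mxE.
  apply: (lin_indep_inj (c' := fun i => a * f u ord0 i + f v ord0 i) bI) i.
  rewrite -fE [in LHS](fE u) [in LHS](fE v) scaler_sumr -big_split.
  by apply: eq_bigr => j _; rewrite scalerDl scalerA.
pose F : {linear V -> 'rV[R]_n} :=
  HB.pack f (GRing.isLinear.Build _ _ _ _ f lf).
by exists F.
Qed.

(** The coordinates of [u] in [b] form a square matrix; independence of [u] makes it row free, hence
    invertible. *)
Lemma lin_basis_dim n (b u : 'I_n -> V) :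
  lin_basis b -> lin_indep u -> lin_basis u.
Proof.
move=> bb uI; split=> // v; have [phi phiE] := lin_basis_coord bb.
have phi0 w : phi w = 0 -> w = 0.
  by move=> w0; rewrite (phiE w) w0; apply: big1 => i _; rewrite mxE scale0r.
pose M := \matrix_i phi (u i).
have phiM (c : 'rV_n) : phi (\sum_i c ord0 i *: u i) = c *m M.
  rewrite mulmx_sum_row linear_sum; apply: eq_bigr => i _.
  by rewrite linearZ rowK.
have Mf : row_full M.
  rewrite row_full_unit -row_free_unit; apply/inj_row_free => c.
  by rewrite -phiM => /phi0/uI c0; apply/rowP => i; rewrite c0 mxE.
exists (fun i => (phi v *m pinvmx M) ord0 i); apply/eqP; rewrite -subr_eq0.
apply/eqP/phi0; rewrite linearB /= phiM mulmxKpV ?subrr//.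
exact: submx_full.
Qed.

Lemma lin_basis_iso n (f : {linear 'rV[R]_n -> V}) :
  injective f -> (forall v, exists c, f c = v) ->
  lin_basis (fun i => f (delta_mx ord0 i)).
Proof.
move=> fI fS.
have fE c : \sum_i c i *: f (delta_mx ord0 i) = f (\row_i c i).
  rewrite [in RHS](row_sum_delta (\row_i c i)) linear_sum.
  by apply: eq_bigr => i _; rewrite linearZ mxE.
split=> [c|v].
  rewrite fE => f0; have /fI/rowP c0 : f (\row_i c i) = f 0 by rewrite linear0.
  by move=> i; have := c0 i; rewrite !mxE.
have [c <-] := fS v; exists (fun i => c ord0 i); rewrite fE; congr (f _).
by apply/rowP => i; rewrite mxE.
Qed.

End bases.

(** * Finite-dimensional normed spaces *)

Section finite_dimension.
Context {R : realType}.
Implicit Types (V W : normedModType R) (n : nat).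

Lemma rV_coord_le n (c : 'rV[R]_n) i : `|c ord0 i| <= `|c|.
Proof.
rewrite [leRHS]/Num.norm /= mx_normrE.
exact: (le_bigmax _ (fun ij => `|c ij.1 ij.2|) (ord0, i)).
Qed.

Lemma linear_bound_continuous V W (f : {linear V -> W}) (M : R) :
  (forall x, `|f x| <= M * `|x|) -> continuous f.
Proof.
move=> fM; apply: bounded_linear_continuous; apply/linear_boundedP.
exists M; split; first exact: num_real.
by move=> r Mr x; rewrite (le_trans (fM x))// ler_wpM2r// ltW.
Qed.

Lemma bop_continuous V W (T : bop V W) : continuous (T : V -> W).
Proof.
have [_ [M TM]] := bopP T.
exact: (@linear_bound_continuous _ _ T M).
Qed.

Section lincomb.
Context {V : normedModType R} {n : nat} (b : 'I_n -> V).

(** The coefficients form a row vector, so that compactness in ['rV[R]_n] can be carried over to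
    [V]. *)
Definition lincomb (c : 'rV[R]_n) : V := \sum_i c ord0 i *: b i.

Lemma lincomb_linear : linear lincomb.
Proof.
move=> a u v; rewrite /lincomb scaler_sumr -big_split.
by apply: eq_bigr => i _; rewrite !mxE scalerDl scalerA.
Qed.

HB.instance Definition _ :=
  GRing.isLinear.Build R 'rV[R]_n V _ lincomb lincomb_linear.

Lemma lincomb_continuous : continuous lincomb.
Proof.
apply: (@linear_bound_continuous _ _ lincomb (\sum_i `|b i|)) => c.
rewrite (le_trans (ler_norm_sum _ _ _))// mulr_suml ler_sum// => i _.
by rewrite normrZ mulrC ler_wpM2l// rV_coord_le.
Qed.

(** The norm of [lincomb c] has a minimum on the compact unit sphere of ['rV[R]_n], positive by
    independence; homogeneity does the rest. *)
Lemma lincomb_norm_lb : lin_indep b ->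
  exists2 m : R, 0 < m & forall c, m * `|c| <= `|lincomb c|.
Proof.
move=> bI; pose S := [set c : 'rV[R]_n | `|c| = 1].
have scaled (c : 'rV[R]_n) : c != 0 -> S (`|c|^-1 *: c).
  by move=> c0; rewrite /S/= normrZ normfV normr_id mulVf// normr_eq0.
(* The sphere is empty when [n = 0]; then only [c = 0] occurs and any positive constant serves. *)
have [S0|S0] := pselect (S !=set0); last first.
  exists 1 => // c; have [->|/scaled Sc] := eqVneq c 0.
    by rewrite normr0 mulr0.
  by exfalso; apply: S0; exists (`|c|^-1 *: c).
have cS : compact S.
  apply: bounded_closed_compact.
    by exists 1; split=> // M M1 c /= ->; exact: ltW.
  rewrite (_ : S = (fun c : 'rV[R]_n => `|c|) @^-1` [set 1]); last by [].
  by apply: closed_comp => [c _|]; [exact: norm_continuous|exact: closed_eq].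
have cf : {within S, continuous (fun c => `|lincomb c|)}.
  apply: continuous_subspaceT => c; apply: continuous_comp.
    exact: lincomb_continuous.
  exact: norm_continuous.
have [c0 c0S cmin] := compact_EVT_min S0 cS cf.
exists `|lincomb c0|.
  rewrite normr_gt0; apply/eqP => /bI c00.
  have : `|c0| = 1 by move: c0S; rewrite inE.
  rewrite (_ : c0 = 0) ?normr0; first by move/eqP; rewrite eq_sym oner_eq0.
  by apply/rowP => i; rewrite c00 mxE.
move=> c; have [->|c0'] := eqVneq c 0; first by rewrite linear0 !normr0 mulr0.
have := cmin _ (mem_set (scaled _ c0')).
by rewrite linearZ/= normrZ normfV normr_id ler_pdivlMl ?normr_gt0// mulrC.
Qed.

End lincomb.

(** The ball is the image under [lincomb b] of a closed set [K], which is bounded by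
    [lincomb_norm_lb]. *)
Lemma finite_dim_compact V n :
  has_dim [set: V] n -> compact (unit_ball V).
Proof.
move=> /has_dimTP[b [bI bT]].
have [m m0 mb] := lincomb_norm_lb bI.
pose K : set 'rV[R]_n := lincomb b @^-1` unit_ball V.
have -> : unit_ball V = lincomb b @` K.
  apply/seteqP; split=> [v v1|_ [c Kc <-]//].
  have [c cv] := bT v; exists (\row_i c i).
    rewrite /K/= /lincomb; under eq_bigr do rewrite mxE.
    by rewrite -cv.
  by rewrite cv /lincomb; apply: eq_bigr => i _; rewrite mxE.
apply: continuous_compact.
  by apply: continuous_subspaceT; exact: lincomb_continuous.
apply: bounded_closed_compact.
  exists m^-1; split; first exact: num_real.
  move=> M mM c Kc /=; rewrite (le_trans _ (ltW mM))// -[m^-1]mulr1.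
  by rewrite ler_pdivlMl// (le_trans (mb c)).
apply: closed_comp => [c _|]; first exact: lincomb_continuous.
rewrite (_ : unit_ball V = (fun x : V => `|x|) @^-1` [set r | r <= 1]);
  last by [].
by apply: closed_comp => [c _|]; [exact: norm_continuous|exact: closed_le].
Qed.

Lemma finite_dim_bounded V W n (f : {linear V -> W}) :
  has_dim [set: V] n -> exists M : R, forall x, `|f x| <= M * `|x|.
Proof.
move=> /has_dimTP[b [bI bT]].
have [m m0 mb] := lincomb_norm_lb bI.
exists ((\sum_i `|f (b i)|) / m) => x.
have [c xE] := bT x; pose d : 'rV[R]_n := \row_i c i.
have dx : lincomb b d = x.
  by rewrite xE /lincomb; apply: eq_bigr => i _; rewrite mxE.
rewrite xE linear_sum (le_trans (ler_norm_sum _ _ _))// -xE.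
rewrite mulrAC -mulrA mulr_suml ler_sum// => i _.
rewrite linearZ normrZ mulrC ler_wpM2l// ler_pdivlMr// mulrC -dx.
rewrite (le_trans _ (mb d))// ler_wpM2l ?(ltW m0)//.
by have := rV_coord_le d i; rewrite mxE.
Qed.

Lemma lin_basis_bop V W n (b : 'I_n -> V) (w : 'I_n -> W) :
  lin_basis b -> exists S : bop V W, forall i, S (b i) = w i.
Proof.
move=> bb; have [phi phiE] := lin_basis_coord bb.
pose f v := lincomb w (phi v).
have lf : linear f by move=> a u v; rewrite /f linearP linearP.
pose F : {linear V -> W} := HB.pack f (GRing.isLinear.Build _ _ _ _ f lf).
have dV : has_dim [set: V] n by apply/has_dimTP; exists b.
have Fb : (F : V -> W) \in @bounded_linear _ V W.
  by apply/mem_set; split; [exact: lf|exact: finite_dim_bounded F dV].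
have phib i : phi (b i) = delta_mx ord0 i.
  apply/rowP; apply: (lin_indep_inj (proj1 bb)).
  rewrite -phiE (bigD1 i)//= big1 ?addr0 ?mxE ?eqxx ?scale1r//.
  by move=> j /negPf ji; rewrite mxE ji andbF scale0r.
exists (BOp Fb) => i /=; rewrite /f phib /lincomb (bigD1 i)//= big1 ?addr0.
  by rewrite mxE !eqxx scale1r.
by move=> j /negPf ji; rewrite mxE ji andbF scale0r.
Qed.

Lemma lin_basis_bop_eq V W n (b : 'I_n -> V) (S T : bop V W) :
  lin_basis b -> (forall i, S (b i) = T (b i)) -> S = T.
Proof.
move=> [_ bT] ST; apply/val_inj/funext => x /=; have [c ->] := bT x.
by rewrite !linear_sum; apply: eq_bigr => i _; rewrite !linearZ/= ST.
Qed.

Lemma bopDE V W (S T : bop V W) x : (S + T) x = S x + T x.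
Proof. by []. Qed.

Lemma bopZE V W a (T : bop V W) x : (a *: T) x = a *: T x.
Proof. by []. Qed.

(** A row vector of length [m * n] is read as a matrix whose row [i] lists the coordinates in [e] of
    the image of [b i]. *)
Lemma has_dim_bop V W m n : has_dim [set: V] m -> has_dim [set: W] n ->
  has_dim [set: bop V W] (m * n).
Proof.
move=> /has_dimTP[b bb] /has_dimTP[e ee]; apply/has_dimTP.
pose g (c : 'rV[R]_(m * n)) i := lincomb e (row i (vec_mx c)).
pose f c := sval (cid (lin_basis_bop (g c) bb)).
have fE c i : f c (b i) = g c i by rewrite /f; case: cid.
have lf : linear f.
  move=> a u v; apply: (lin_basis_bop_eq bb) => i.
  by rewrite fE bopDE bopZE !fE /g !linearP.
pose F : {linear 'rV[R]_(m * n) -> bop V W} :=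
  HB.pack f (GRing.isLinear.Build _ _ _ _ f lf).
have ge0 (c : 'rV[R]_n) : lincomb e c = 0 -> c = 0.
  by move=> /(proj1 ee) c0; apply/rowP => j; rewrite c0 mxE.
exists (fun i => F (delta_mx ord0 i)); apply: lin_basis_iso.
  move=> u v /= uv; apply: (can_inj (@vec_mxK _ m n)).
  apply/row_matrixP => i; apply/eqP; rewrite -subr_eq0; apply/eqP/ge0.
  rewrite linearB/= -/(g u i) -/(g v i).
  by have := fE u i; rewrite [f u]uv fE => ->; rewrite subrr.
move=> T; have coords i : exists c : 'rV[R]_n, lincomb e c = T (b i).
  have [c ->] := proj2 ee (T (b i)); exists (\row_j c j).
  by rewrite /lincomb; apply: eq_bigr => j _; rewrite mxE.
exists (mxvec (\matrix_i sval (cid (coords i)))).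
apply: (lin_basis_bop_eq bb) => i /=; rewrite fE /g mxvecK rowK.
by case: cid.
Qed.

Lemma has_dim_scalars : has_dim [set: R^o] 1.
Proof.
apply/has_dimTP; exists (fun=> 1); split.
  by move=> c; rewrite big_ord1 => /eqP; rewrite [_ *: _]mulr1 => /eqP c0 i;
    rewrite ord1.
by move=> v; exists (fun=> v); rewrite big_ord1 [_ *: _]mulr1.
Qed.

Lemma has_dim_dual V n : has_dim [set: V] n -> has_dim [set: bop V R^o] n.
Proof.
by move=> dV; rewrite -[n]muln1; exact: has_dim_bop dV has_dim_scalars.
Qed.

End finite_dimension.

(** * Annihilators in the dual *)

Section annihilator.
Context {R : realType}.
Implicit Types (V : normedModType R) (n d : nat).

Definition annihilator V (A : set (bop V R^o)) : set V :=
  [set v | forall f, A f -> f v = 0].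

(** A free family has at most [n] members, so one of largest size exists; as no [g] in [A] can be
    added to it, its rows span every [ev g]. *)
Lemma maximal_free_family V (A : set (bop V R^o)) n (b : 'I_n -> V) :
  lin_basis b -> let ev (f : bop V R^o) : 'rV[R]_n := \row_j f (b j) in
  exists k (f : 'I_k -> bop V R^o),
    [/\ forall i, A (f i), row_free (\matrix_i ev (f i)) &
        forall g, A g -> (ev g <= \matrix_i ev (f i))%MS].
Proof.
move=> bb ev.
pose P k := `[< exists f : 'I_k -> bop V R^o,
  (forall i, A (f i)) /\ row_free (\matrix_i ev (f i)) >].
have P0 : exists k, P k.
  exists 0%N; apply/asboolP; exists (fun=> 0); split; first by case.
  by rewrite /row_free flatmx0 mxrank0.
have Pn k : P k -> (k <= n)%N.
  by move=> /asboolP[f [_ /eqP <-]]; exact: rank_leq_col.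
case: (ex_maxnP P0 Pn) => k /asboolP[f [Af fM]] kmax; exists k, f; split=> //.
move=> g Ag; apply: contrapT => gM.
suff /kmax : P k.+1 by rewrite ltnn.
apply/asboolP; exists (fun i => oapp f g (unlift ord0 i)); split.
  by move=> i; case: (unliftP ord0 i) => [j|] _; [exact: Af|].
apply/inj_row_free => c.
rewrite mulmx_sum_row big_ord_recl rowK unlift_none/=.
pose c' : 'rV_k := \row_i c ord0 (lift ord0 i).
have -> : \sum_(i < k) c ord0 (lift ord0 i) *:
    row (lift ord0 i) (\matrix_i0 ev (oapp f g (unlift ord0 i0))) =
    c' *m \matrix_i ev (f i).
  by rewrite mulmx_sum_row; apply: eq_bigr => i _; rewrite !rowK liftK/= mxE.
(* The enlarged family has [g] at index 0. A nonzero coefficient there would put [ev g] in the row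
   space of the old family, against [gM]. *)
have [c0|c0] := eqVneq (c ord0 ord0) 0; last first.
  move=> /(canRL (addrK _)); rewrite sub0r => gE; exfalso; apply: gM.
  by rewrite -(eqmx_scale _ c0) gE -mulNmx submxMl.
rewrite c0 scale0r add0r => /eqP; rewrite mulmx_free_eq0// => /eqP c'0.
apply/rowP => i; rewrite mxE; case: (unliftP ord0 i) => [j|] -> //.
by have /rowP/(_ j) := c'0; rewrite !mxE.
Qed.

(** Let [M] be the matrix of a maximal free family of [k] functionals in [A]. In coordinates the
    annihilator is the kernel of [M^T], so [d = n - k], and the family is a basis of the span. *)
Lemma has_dim_span_annihilator V (A : set (bop V R^o)) n d :
  has_dim [set: V] n -> has_dim (annihilator A) d ->
  has_dim (lin_span A) (n - d).
Proof.
move=> /has_dimTP[b bb] [a [aI aE]].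
pose ev (f : bop V R^o) : 'rV[R]_n := \row_j f (b j).
have [k [f [Af fM Ms]]] : exists k (f : 'I_k -> bop V R^o),
    [/\ forall i, A (f i), row_free (\matrix_i ev (f i)) &
        forall g, A g -> (ev g <= \matrix_i ev (f i))%MS].
  exact: maximal_free_family.
set M := \matrix_i ev (f i) in fM Ms.
have evI g h : ev g = ev h -> g = h.
  move=> /rowP gh; apply: (lin_basis_bop_eq bb) => i.
  by have := gh i; rewrite !mxE.
have lev : linear ev by move=> r g h; apply/rowP => j; rewrite !mxE.
pose Ev : {linear bop V R^o -> 'rV[R]_n} :=
  HB.pack ev (GRing.isLinear.Build _ _ _ _ ev lev).
have evsum m (c : 'I_m -> R) (g : 'I_m -> bop V R^o) :
    ev (\sum_i c i *: g i) = \sum_i c i *: ev (g i).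
  rewrite -[ev]/(Ev : _ -> _) linear_sum.
  by apply: eq_bigr => i _; rewrite linearZ.
have [phi phiE] := lin_basis_coord bb.
have evE (g : bop V R^o) v : g v = (phi v *m (ev g)^T) ord0 ord0.
  rewrite {1}(phiE v) linear_sum mxE; apply: eq_bigr => j _.
  by rewrite linearZ !mxE.
have annE v : annihilator A v <-> phi v *m M^T = 0.
  split=> [Av|vM g /Ms /submxP[D gD]]; last first.
    by rewrite evE gD trmx_mul mulmxA vM mul0mx mxE.
  apply/rowP => i; rewrite [RHS]mxE; transitivity (f i v); last exact: Av.
  rewrite (evE (f i) v) mxE [RHS]mxE.
  by apply: eq_bigr => j _; rewrite !mxE.
pose N := \matrix_i phi (a i).
have phisum m (c : 'I_m -> R) (u : 'I_m -> V) :
    phi (\sum_i c i *: u i) = \sum_i c i *: phi (u i).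
  by rewrite linear_sum; apply: eq_bigr => i _; rewrite linearZ.
have phi0 v : phi v = 0 -> v = 0.
  by move=> v0; rewrite (phiE v) v0; apply: big1 => i _; rewrite mxE scale0r.
have Nfree : row_free N.
  apply/inj_row_free => c; rewrite mulmx_sum_row.
  under eq_bigr do rewrite rowK.
  by rewrite -phisum => /phi0/aI c0; apply/rowP => i; rewrite c0 mxE.
have Nker : (N :=: kermx M^T)%MS.
  apply/eqmxP/andP; split.
    apply/row_subP => i; rewrite rowK; apply/sub_kermxP/annE.
    rewrite aE; exists (fun j => (j == i)%:R).
    rewrite (bigD1 i)//= eqxx scale1r big1 ?addr0// => j /negPf ->.
    by rewrite scale0r.
  apply/rV_subP => u /sub_kermxP uM.
  have phib : phi (lincomb b u) = u.
    apply/rowP; apply: (lin_indep_inj (proj1 bb)); rewrite -phiE.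
    by apply: eq_bigr.
  have /annE : phi (lincomb b u) *m M^T = 0 by rewrite phib.
  rewrite aE => -[c uE].
  apply/submxP; exists (\row_i c i); rewrite -phib uE phisum mulmx_sum_row.
  by apply: eq_bigr => i _; rewrite rowK mxE.
have dk : d = (n - k)%N.
  rewrite -(eqP Nfree) Nker mxrank_ker mxrank_tr; congr (_ - _)%N.
  exact/eqP.
(* Subtraction is truncated: this bound is what turns [n - (n - k)] back into [k]. *)
have kn : (k <= n)%N by rewrite -(eqP fM); exact: rank_leq_col.
rewrite dk subKn//; exists f; split.
  move=> c /(congr1 ev); rewrite evsum -[ev]/(Ev : _ -> _) linear0 => c0.
  have /eqP : (\row_i c i) *m M = 0.
    by rewrite mulmx_sum_row -[RHS]c0; apply: eq_bigr => i _; rewrite rowK mxE.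
  by rewrite mulmx_free_eq0// => /eqP/rowP cE i; have := cE i; rewrite !mxE.
apply/seteqP; split=> [_ [m [c [u [Au ->]]]]|_ [c ->]]; last first.
  by exists k, c, f.
have /submxP[D gD] : (ev (\sum_i c i *: u i)%R <= M)%MS.
  rewrite (evsum _ c u); apply: summx_sub => i _; apply: scalemx_sub.
  exact: Ms.
exists (fun i => D ord0 i); apply: evI; rewrite gD (evsum _ _ f) mulmx_sum_row.
by apply: eq_bigr => i _; rewrite rowK.
Qed.

End annihilator.

(** * Two-dimensional spaces *)

Section plane.
Context {R : realType}.

Definition indep2 {V : lmodType R} (u v : V) : Prop :=
  forall a c : R, a *: u + c *: v = 0 -> a = 0 /\ c = 0.

Definition pair_family {V : lmodType R} (u v : V) (i : 'I_2) : V :=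
  if i == ord0 then u else v.

Lemma sum_pair_family {V : lmodType R} (u v : V) (c : 'I_2 -> R) :
  \sum_i c i *: pair_family u v i = c ord0 *: u + c (lift ord0 ord0) *: v.
Proof. by rewrite big_ord_recl big_ord1. Qed.

Lemma indep2_basis {V : lmodType R} (u v : V) :
  has_dim [set: V] 2 -> indep2 u v -> lin_basis (pair_family u v).
Proof.
move=> /has_dimTP[b bb] uv; apply: (lin_basis_dim bb) => c.
rewrite sum_pair_family => /uv[c0 c1] i.
by case: (unliftP ord0 i) => [j|] ->//; rewrite (ord1 j).
Qed.

Lemma indep2_span {V : lmodType R} (u v x : V) :
  has_dim [set: V] 2 -> indep2 u v -> exists a c : R, x = a *: u + c *: v.
Proof.
move=> dV /(indep2_basis dV)[_ /(_ x)[c ->]].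
by rewrite sum_pair_family; exists (c ord0), (c (lift ord0 ord0)).
Qed.

Lemma indep2_bop {V W : normedModType R} (u v : V) (w z : W) :
  has_dim [set: V] 2 -> indep2 u v ->
  exists S : bop V W, S u = w /\ S v = z.
Proof.
move=> dV /(indep2_basis dV)/(lin_basis_bop (pair_family w z))[S SE].
by exists S; split; [exact: (SE ord0)|exact: (SE (lift ord0 ord0))].
Qed.

Lemma indep2P {V : lmodType R} (u v : V) :
  v != 0 -> (forall k, u != k *: v) -> indep2 u v.
Proof.
move=> v0 uv a c; have [->|a0] := eqVneq a 0.
  rewrite scale0r add0r => /eqP; rewrite scaler_eq0 (negPf v0) orbF => /eqP ->.
  by [].
move=> /(canRL (addrK _)); rewrite sub0r -scaleNr => /(canRL (scalerK a0)).
by rewrite scalerA => /eqP; rewrite (negPf (uv _)).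
Qed.

(** If all vectors were multiples of [z], the basis vectors [k *: z] and [l *: z] would satisfy the
    relation with coefficients [l] and [- k]; so [k = 0] and the first one vanishes, which is
    absurd. *)
Lemma indep2_complete {V : lmodType R} (z : V) :
  has_dim [set: V] 2 -> z != 0 -> exists w, indep2 z w.
Proof.
move=> /has_dimTP[b [bI _]] z0.
suff [w wz] : exists w, forall k, w != k *: z.
  exists w => a c; rewrite addrC => ac0.
  by have [] := indep2P z0 wz ac0.
apply: contrapT => noW.
have mul i : exists k, b i = k *: z.
  apply: contrapT => bz; apply: noW; exists (b i) => k.
  by apply/eqP => bk; apply: bz; exists k.
have [k bk] := mul ord0; have [l bl] := mul (lift ord0 ord0).
have kl : \sum_i (fun i => if i == ord0 then l else - k) i *: b i = 0.
  rewrite big_ord_recl big_ord1 /= bk bl.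
  by rewrite !scalerA mulNr (mulrC l) scaleNr subrr.
have k0 : k = 0.
  by have /eqP := bI _ kl (lift ord0 ord0); rewrite /= oppr_eq0 => /eqP.
have one0 : \sum_i (fun i : 'I_2 => (i == ord0)%:R) i *: b i = 0.
  by rewrite big_ord_recl big_ord1 /= bk k0 !scale0r scaler0 addr0.
by have /eqP := bI _ one0 ord0; rewrite eqxx oner_eq0.
Qed.

Lemma norming_functional (V : normedModType R) (z : V) :
  has_dim [set: V] 2 -> exists y : bop V R^o, `|y| <= 1 /\ y z = `|z|.
Proof.
move=> dV; have [->|z0] := eqVneq z 0.
  by exists 0; rewrite normr0 linear0 normr0 ler01.
have [w zw] := indep2_complete dV z0.
(* One-step Hahn-Banach extension from the line of z: the value c at w must lie
   between a |z| - |a z - w| and |a z + w| - a |z| for every a. *)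
pose A := [set a * `|z| - `|a *: z - w| | a in [set: R]].
have ub a' : ubound A (`|a' *: z + w| - a' * `|z|).
  move=> _ [a _ <-]; rewrite lerBlDr addrAC lerBrDr -mulrDl.
  have aE : (a + a') *: z = (a' *: z + w) + (a *: z - w).
    by rewrite addrACA subrr addr0 scalerDl addrC.
  rewrite (le_trans (ler_norm _))// normrM normr_id -normrZ aE.
  exact: ler_normD.
have A0 : A !=set0 by exists (0 * `|z| - `|0 *: z - w|), 0.
pose c := sup A.
have cl a : a * `|z| - `|a *: z - w| <= c.
  by apply: ub_le_sup; [exists (`|0 *: z + w| - 0 * `|z|); exact: ub|exists a].
have cu a : c <= `|a *: z + w| - a * `|z| by apply: ge_sup => //; exact: ub.
have [y [yz yw]] := indep2_bop (W := R^o) `|z| c dV zw.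
exists y; split=> //.
have yle v : y v <= `|v|.
  have [a [t ->]] := indep2_span v dV zw.
  rewrite linearD !linearZ/= yz yw -![_ *: _]/(_ * _).
  (* Dividing by [|t|] reduces the bound to [cl] at [- a / t] for negative [t] and to [cu] at
     [a / t] for positive [t]. *)
  have [t0|t0|->] := ltgtP t 0.
  - have nt0 : 0 < - t by rewrite oppr_gt0.
    have e : - t * (- a / t) = a.
      by rewrite mulrA mulrNN mulrAC divff ?mul1r// lt_eqF.
    have -> : a *: z + t *: w = - t *: (- a / t *: z - w).
      by rewrite scalerBr scalerA e scaleNr opprK.
    have := ler_wpM2l (ltW nt0) (cl (- a / t)).
    rewrite normrZ (gtr0_norm nt0) mulrBr mulrA e lerBlDl => h.
    by rewrite -[t * c]opprK -mulNr lerBlDl addrC.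
  - have /(ler_wpM2l (ltW t0)) := cu (a / t).
    have -> : a *: z + t *: w = t *: (a / t *: z + w).
      by rewrite scalerDr scalerA mulrCA mulfV ?gt_eqF// mulr1.
    rewrite normrZ (gtr0_norm t0) mulrBr mulrA [t * (a / t)]mulrCA.
    by rewrite mulfV ?gt_eqF// mulr1 lerBrDl.
  - by rewrite mul0r addr0 scale0r addr0 normrZ ler_wpM2r// ler_norm.
apply: opnorm_le => v v1; rewrite ler_norml (le_trans (yle v))// andbT.
by rewrite lerNl -linearN (le_trans (yle _))// normrN.
Qed.

End plane.

(** * The annihilator of the support functionals of an operator *)

Section operators.
Context {R : realType}.

Lemma bop_le {V W : normedModType R} (T : bop V W) x : `|T x| <= `|T| * `|x|.
Proof.
have [->|x0] := eqVneq x 0; first by rewrite linear0 !normr0 mulr0.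
have : `|T (`|x|^-1 *: x)| <= `|T|.
  by apply: opnorm_ub; rewrite normrZ normfV normr_id mulVf ?normr_eq0.
by rewrite linearZ normrZ normfV normr_id ler_pdivrMl ?normr_gt0// mulrC.
Qed.

Lemma bop_le1 {V W : normedModType R} (T : bop V W) x :
  `|T| <= 1 -> `|x| <= 1 -> `|T x| <= 1.
Proof.
by move=> T1 x1; rewrite (le_trans (bop_le T x))// mulr_ile1.
Qed.

(** The increment from [p0] to [p] is at most [h p], obtained by changing first the functional and
    then the vector; [h] tends to 0. *)
Lemma eval_continuous (V W : normedModType R) (S : bop V W) :
  continuous (fun p : V * bop W R^o => p.2 (S p.1) : R).
Proof.
move=> p0; apply/(@subr_cvg0 R); apply: norm_cvg0.
pose h (p : V * bop W R^o) : R :=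
  `|p.2 - p0.2| * `|S p.1| + `|p0.2| * `|S p.1 - S p0.1|.
apply: (@squeeze_cvgr _ _ _ _ (fun=> 0) h).
  near=> p; rewrite normr_ge0/=.
  have -> : p.2 (S p.1) - p0.2 (S p0.1) =
      (p.2 - p0.2) (S p.1) + p0.2 (S p.1 - S p0.1) :> R^o.
    by rewrite linearB/= addrA subrK.
  by rewrite (le_trans (ler_normD _ _))// lerD// bop_le.
  exact: cvg_cst.
have cS : S p.1 @[p --> p0] --> S p0.1.
  by apply: continuous_comp; [exact: cvg_fst|exact: bop_continuous].
have -> : 0 = `|p0.2 - p0.2| * `|S p0.1| + `|p0.2| * `|S p0.1 - S p0.1| :> R.
  by rewrite !subrr !normr0 mul0r mulr0 addr0.
apply: cvgD; apply: cvgM.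
- by apply: cvg_norm; apply: cvgB; [exact: cvg_snd|exact: cvg_cst].
- exact: cvg_norm.
- exact: cvg_cst.
- by apply: cvg_norm; apply: cvgB => //; exact: cvg_cst.
Unshelve. all: by end_near. Qed.

(** All inequalities in [1 = y (T x) <= |y| |T x| <= |T x| <= |x| <= 1] must be equalities. *)
Lemma supp_fun_attains {V W : normedModType R} (T : bop V W) (y : bop W R^o)
    (x : V) : `|T| = 1 -> `|x| <= 1 -> `|y| <= 1 -> y (T x) = 1 ->
  norm_attainment T x /\ supp_funs (T x) y.
Proof.
move=> T1 x1 y1 yTx.
have Tx1 : `|T x| <= `|x| by rewrite (le_trans (bop_le T x))// T1 mul1r.
have yx : 1 <= `|y| * `|T x|.
  by rewrite (le_trans _ (bop_le y _))// yTx normr1.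
have yTx1 : 1 <= `|T x| by rewrite (le_trans yx)// ler_piMl.
have y1' : 1 <= `|y|.
  by rewrite (le_trans yx)// ler_piMr// (le_trans Tx1).
split; split.
- by apply/eqP; rewrite eq_le x1 (le_trans yTx1).
- by apply/eqP; rewrite T1 eq_le yTx1 (le_trans Tx1).
- by apply/eqP; rewrite eq_le y1.
- exact: yTx.
Qed.

(** These rank-one functionals are the members of J(T) that tie it to pairs of a point of M_T and a
    support functional. *)
Lemma tensor_functional {V W : normedModType R} (y : bop W R^o) (x : V) :
  exists f : bop (bop V W) R^o, forall S, f S = y (S x).
Proof.
pose f (S : bop V W) : R^o := y (S x).
have lf : linear f by move=> a S S'; rewrite /f -linearP.
have bf : f \in @bounded_linear _ (bop V W) R^o.
  apply/mem_set; split=> //; exists (`|y| * `|x|) => S.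
  by rewrite (le_trans (bop_le y _))// -mulrA ler_wpM2l// mulrC bop_le.
by exists (BOp bf).
Qed.

(** This is the space [N] of the overview, with [x] over all of M_T; [supp_null_extreme] cuts this
    down to extreme points. *)
Definition supp_null {V W : normedModType R} (T : bop V W) : set (bop V W) :=
  [set S | forall x y, norm_attainment T x -> supp_funs (T x) y -> y (S x) = 0].

(** A derivative-free form of the fact that the right derivative of [|T + t *: S|] at 0 is at most
    0. *)
Lemma supp_null_le {V W : normedModType R} (T S : bop V W) (e : R) m :
  has_dim [set: V] m -> has_dim [set: W] 2 -> `|T| = 1 -> supp_null T S ->
  0 < e -> exists2 t, 0 < t & `|T + t *: S| <= 1 + t * e.
Proof.
move=> dV dW T1 TS e0.
pose K := unit_ball V `*` unit_ball (bop W R^o).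
pose g (p : V * bop W R^o) : R := p.2 (T p.1).
pose h (p : V * bop W R^o) : R := p.2 (S p.1).
have gK p : K p -> g p <= 1.
  by move=> [p1 p2]; rewrite (le_trans (ler_norm _))// bop_le1// bop_le1// T1.
have hK p : K p -> h p <= `|S|.
  move=> [p1 p2]; rewrite (le_trans (ler_norm _))// (le_trans (bop_le _ _))//.
  by rewrite -[leRHS]mul1r ler_pM//; exact: opnorm_ub.
(* Norming functionals turn the operator norm into a supremum over the compact set [K]. *)
suff [t t0 tK] : exists2 t, 0 < t & forall p, K p -> g p + t * h p <= 1 + t * e.
  exists t => //; apply: opnorm_le => x x1.
  have [y [y1 <-]] := norming_functional (T x + t *: S x) dW.
  by rewrite linearD linearZ/=; exact: (tK (x, y)).
(* On the compact set C, where y (S x) is large, y (T x) stays away from 1;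
   otherwise the maximum point would contradict [supp_null T S]. *)
pose C := K `&` [set p | e <= h p].
have cK : compact K.
  by apply: compact_setX; apply: finite_dim_compact;
    [exact: dV|exact: has_dim_dual dW].
have cC : compact C.
  apply: compact_closedI => //.
  rewrite (_ : mkset _ = h @^-1` [set r | e <= r]); last by [].
  by apply: closed_comp => [p _|]; [exact: eval_continuous|exact: closed_ge].
have small p t : 0 <= t -> K p -> ~ C p -> g p + t * h p <= 1 + t * e.
  move=> t0 Kp nC; rewrite lerD ?gK// ler_wpM2l// leNgt; apply/negP => /ltW eh.
  exact: nC.
have [C0|nC0] := pselect (C !=set0); last first.
  exists 1 => // p Kp; apply: small => // Cp.
  by apply: nC0; exists p.
have cg : {within C, continuous g}.
  by apply: continuous_subspaceT; exact: eval_continuous.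
have [p1 /set_mem Cp1 p1max] := compact_EVT_max C0 cC cg.
have gp1 : g p1 < 1.
  rewrite lt_neqAle gK ?andbT; last exact: Cp1.1.
  apply/eqP => gp1.
  have [[x1 y1] eh] := Cp1.
  have [Mx Jy] := supp_fun_attains T1 x1 y1 gp1.
  by move: eh; rewrite /= /h (TS _ _ Mx Jy) leNgt e0.
have S1 : 0 < `|S| + 1 by rewrite ltr_wpDl.
(* With this [t], the term [t * h p] is at most the gap [1 - g p1], hence at most [1 - g p] on [C];
   adding 1 keeps the denominator positive. *)
have t0 : 0 < (1 - g p1) / (`|S| + 1) by rewrite divr_gt0// subr_gt0.
exists ((1 - g p1) / (`|S| + 1)) => // p Kp.
have [Cp|nCp] := pselect (C p); last exact: small (ltW t0) Kp nCp.
rewrite (@le_trans _ _ 1)//; last by rewrite lerDl mulr_ge0// ltW.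
rewrite -lerBrDl -mulrA (le_trans _ (_ : 1 - g p1 <= _))//; last first.
  by rewrite lerD2l lerN2 p1max// inE.
rewrite ler_piMr ?subr_ge0 ?(ltW gp1)// ler_pdivrMl// mulr1.
by rewrite (le_trans (hK _ Kp))// lerDl.
Qed.

(** One inclusion holds because the functionals of [tensor_functional] lie in J(T). For the other,
    [f] in J(T) gives [1 + t * f S = f (T + t *: S) <= 1 + t * e], so [f S <= 0], and the same for
    [- S]. *)
Lemma annihilator_supp_funs {V W : normedModType R} (T : bop V W) m :
  has_dim [set: V] m -> has_dim [set: W] 2 -> `|T| = 1 ->
  annihilator (supp_funs T) = supp_null T.
Proof.
move=> dV dW T1; apply/seteqP; split=> S.
  move=> TS x y [x1 Tx] [y1 yTx]; have [f fE] := tensor_functional y x.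
  rewrite -fE; apply: TS; split; last by rewrite fE.
  apply/eqP; rewrite eq_le; apply/andP; split.
    apply: opnorm_le => S' S'1; rewrite fE bop_le1 ?y1//.
    by rewrite bop_le1 ?x1.
  by have := bop_le f T; rewrite fE yTx normr1 T1 mulr1.
move=> TS f [f1 fT].
have fle (S' : bop V W) : supp_null T S' -> f S' <= 0.
  move=> TS'; apply/ler_addgt0Pl => e e0; rewrite addr0.
  have [t t0 tS] := supp_null_le dV dW T1 TS' e0.
  have : f (T + t *: S') <= 1 + t * e.
    by rewrite (le_trans (ler_norm _))// (le_trans (bop_le _ _))// f1 mul1r.
  by rewrite linearD linearZ/= fT lerD2l ler_pM2l.
apply/eqP; rewrite eq_le fle//=.
rewrite -[leRHS]opprK lerNr oppr0 -linearN; apply: fle => x y Mx Jy.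
have -> : y ((- S) x) = - y (S x) by exact: (linearN y).
by rewrite (TS _ _ Mx Jy) oppr0.
Qed.

End operators.

(** * Extreme points of the unit ball of a plane *)

Section extreme.
Context {R : realType}.

Lemma convex_comb_eq_max (t a c m : R) : 0 < t < 1 -> a <= m -> c <= m ->
  t * a + (1 - t) * c = m -> a = m /\ c = m.
Proof.
move=> /andP[t0 t1] am cm tm.
have t1' : 0 < 1 - t by rewrite subr_gt0.
have h1 : 0 <= t * (m - a) by rewrite mulr_ge0 ?(ltW t0) ?subr_ge0.
have h2 : 0 <= (1 - t) * (m - c) by rewrite mulr_ge0 ?(ltW t1') ?subr_ge0.
have h3 : t * (m - a) + (1 - t) * (m - c) = 0 by rewrite -[in LHS]tm; ring.
have /eqP : t * (m - a) = 0 by lra.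
have /eqP : (1 - t) * (m - c) = 0 by lra.
rewrite mulf_eq0 (gt_eqF t1')/= subr_eq0 => /eqP <-.
by rewrite mulf_eq0 (gt_eqF t0)/= subr_eq0 => /eqP <-.
Qed.


(** The admissible [c] are bounded by [2 / |v|], by the triangle inequality; their supremum is
    admissible by approximation. *)
Lemma ray_end (V : normedModType R) (x0 v : V) : `|x0| <= 1 -> v != 0 ->
  exists s : R, [/\ 0 <= s, `|x0 + s *: v| <= 1 &
    forall c, `|x0 + c *: v| <= 1 -> c <= s].
Proof.
move=> x01 v0; pose I := [set c : R | `|x0 + c *: v| <= 1].
have I0 : I 0 by rewrite /I/= scale0r addr0.
have Ib : ubound I (2 / `|v|).
  move=> c Ic; rewrite ler_pdivlMr ?normr_gt0//.
  rewrite (le_trans (ler_wpM2r _ (ler_norm c)))// -normrZ.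
  rewrite -[c *: v](addKr x0) (le_trans (ler_normD _ _))// normrN.
  by rewrite (_ : 2 = 1 + 1)// lerD.
have supI : has_sup I by split; [exists 0|exists (2 / `|v|)].
exists (sup I); split; first exact: sup_upper_bound.
  apply/ler_addgt0Pr => e e0.
  have [|c Ic cI] := @sup_adherent _ I (e / `|v|) _ supI.
    by rewrite divr_gt0// normr_gt0.
  have cs : c <= sup I by exact: sup_upper_bound.
  have -> : x0 + sup I *: v = (x0 + c *: v) + (sup I - c) *: v.
    by rewrite scalerBl -addrA [c *: v + _]addrC subrK.
  rewrite (le_trans (ler_normD _ _))// lerD// normrZ ger0_norm ?subr_ge0//.
  by rewrite -ler_pdivlMr ?normr_gt0// lerBlDl -lerBlDr ltW.
by move=> c Ic; exact: sup_upper_bound.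
Qed.

Lemma level_segment (V : normedModType R) (phi : {linear V -> R^o}) (x0 : V) :
  has_dim [set: V] 2 -> `|x0| <= 1 -> phi x0 = 1 ->
  exists v s1 s2, [/\ phi v = 0, s1 <= 0 <= s2,
    `|x0 + s1 *: v| <= 1, `|x0 + s2 *: v| <= 1 &
    forall x, `|x| <= 1 -> phi x = 1 ->
      exists2 c, s1 <= c <= s2 & x = x0 + c *: v].
Proof.
move=> dV x01 phi1.
have x0N0 : x0 != 0.
  by apply/eqP => x00; move/eqP: phi1; rewrite x00 linear0 eq_sym oner_eq0.
have [w x0w] := indep2_complete dV x0N0.
(* The projection of [w] along [x0] onto the kernel of [phi]: the level line through [x0] has
   direction [v]. *)
pose v := w - phi w *: x0.
have phiv : phi v = 0.
  by rewrite linearB linearZ/= phi1 [_ *: _]mulr1 subrr.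
have x0v : indep2 x0 v.
  move=> a c av0; have /x0w[h c0] : (a - c * phi w) *: x0 + c *: w = 0.
    by rewrite -[RHS]av0 scalerBr scalerBl scalerA -addrA [- _ + _]addrC.
  by split=> //; move: h; rewrite c0 mul0r subr0.
have v0 : v != 0.
  apply/eqP => v0; have [_ /eqP] : 0 = 0 :> R /\ 1 = 0 :> R.
    by apply: x0v; rewrite v0 scale0r scaler0 addr0.
  by rewrite oner_eq0.
have [s2 [s2_ge0 s2v s2max]] := ray_end x01 v0.
have [|s1 [s1_ge0 s1v s1max]] := ray_end (v := - v) x01.
  by rewrite oppr_eq0.
exists v, (- s1), s2; split=> //.
- by rewrite oppr_le0 s1_ge0.
- by rewrite scaleNr -scalerN.
move=> x x1 phix; have [a [c xE]] := indep2_span x dV x0v.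
have a1 : a = 1.
  by move: phix; rewrite xE linearD !linearZ/= phi1 phiv scaler0
    addr0 [_ *: _]mulr1.
rewrite a1 scale1r in xE; exists c => //; apply/andP; split.
  by rewrite lerNl; apply: s1max; rewrite scaleNr scalerN opprK -xE.
by apply: s2max; rewrite -xE.
Qed.

(** Since [phi <= 1] on the ball, the level 1 is a face: a proper convex combination in it has both
    points in it. The claim then becomes extremality of an endpoint of the interval from [s1] to
    [s2]. *)
Lemma level_endpoint_extreme (V : normedModType R) (phi : {linear V -> R^o})
    (x0 v : V) (s1 s2 s : R) :
  (forall x, `|x| <= 1 -> phi x <= 1) -> phi x0 = 1 -> phi v = 0 ->
  (forall x, `|x| <= 1 -> phi x = 1 ->
     exists2 c, s1 <= c <= s2 & x = x0 + c *: v) ->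
  s = s1 \/ s = s2 -> `|x0 + s *: v| <= 1 ->
  extreme_points (unit_ball V) (x0 + s *: v).
Proof.
move=> phile phi0 phiv seg s12 sB; split=> // p q t pB qB t01 xE.
have phis : t * phi p + (1 - t) * phi q = 1.
  move/(congr1 phi): xE; rewrite !linearD !linearZ/= phi0 phiv scaler0 addr0.
  by move=> h; rewrite [RHS]h.
have [phip phiq] : phi p = 1 /\ phi q = 1.
  exact: (convex_comb_eq_max t01 (phile _ pB) (phile _ qB) phis).
have [a /andP[a1 a2] pE] := seg _ pB phip.
have [c /andP[c1 c2] qE] := seg _ qB phiq.
have [v0|v0] := eqVneq v 0; first by rewrite pE qE v0 !scaler0.
suff acs : t * a + (1 - t) * c = s.
  rewrite pE qE; congr (_ + _ *: _); case: s12 => ss; last first.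
    rewrite ss in acs.
    by have [-> ->] := convex_comb_eq_max t01 a2 c2 acs.
  have acs' : t * - a + (1 - t) * - c = - s1.
    by rewrite -ss -acs; ring.
  have aN : - a <= - s1 by rewrite lerN2.
  have cN : - c <= - s1 by rewrite lerN2.
  have [/oppr_inj -> /oppr_inj ->//] := convex_comb_eq_max t01 aN cN acs'.
have : (s - (t * a + (1 - t) * c)) *: v = 0.
  move: xE; rewrite pE qE !scalerDr addrACA -scalerDl subrKC scale1r.
  move/addrI; rewrite !scalerA -scalerDl => /eqP.
  by rewrite -subr_eq0 -scalerBl => /eqP.
by move/eqP; rewrite scaler_eq0 (negPf v0) orbF subr_eq0 => /eqP ->.
Qed.

(** Only the two ends of the level segment can be extreme; [0, 0] is a default when the level misses
    the ball. *)
Lemma extreme_level (V : normedModType R) (phi : {linear V -> R^o}) :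
  has_dim [set: V] 2 -> exists p q, forall x,
    extreme_points (unit_ball V) x -> phi x = 1 -> x = p \/ x = q.
Proof.
move=> dV.
have [[x0 [x01 phi0]]|none] :=
    pselect (exists x0, `|x0| <= 1 /\ phi x0 = 1); last first.
  by exists 0, 0 => x [xB _] phix; exfalso; apply: none; exists x.
have [v [s1 [s2 [phiv _ s1B s2B seg]]]] := level_segment dV x01 phi0.
exists (x0 + s1 *: v), (x0 + s2 *: v) => x [xB xext] phix.
have [c /andP[c1 c2] xE] := seg _ xB phix.
have [cs1|cs1] := eqVneq c s1; first by left; rewrite xE cs1.
have [cs2|cs2] := eqVneq c s2; first by right; rewrite xE cs2.
have c1' : s1 < c by rewrite lt_neqAle eq_sym cs1.
have c2' : c < s2 by rewrite lt_neqAle cs2.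
have s12 : 0 < s2 - s1 by rewrite subr_gt0 (lt_trans c1').
have tE : (s2 - c) / (s2 - s1) * s1 + (1 - (s2 - c) / (s2 - s1)) * s2 = c.
  by field; rewrite gt_eqF.
have t01 : 0 < (s2 - c) / (s2 - s1) < 1.
  apply/andP; split; first by rewrite divr_gt0// subr_gt0.
  by rewrite ltr_pdivrMr// mul1r ltrD2l ltrN2.
have := xext _ _ _ s1B s2B t01.
set t := (s2 - c) / (s2 - s1) in tE t01 *.
have -> : t *: (x0 + s1 *: v) + (1 - t) *: (x0 + s2 *: v) = x.
  by rewrite !scalerDr addrACA -scalerDl subrKC scale1r !scalerA -scalerDl tE.
(* Extremality of an inner point makes the two ends coincide; as [s1 < s2], this forces [v = 0] and
   all points of the segment agree. *)
move=> /(_ erefl) ends; left; rewrite ends.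
have : (c - s2) *: v = 0.
  have /addrI/eqP := ends; rewrite -subr_eq0 -scalerBl scaler_eq0.
  by rewrite subr_eq0 (lt_eqF (lt_trans c1' c2'))/= => /eqP ->; rewrite scaler0.
by rewrite xE scalerBl => /eqP; rewrite subr_eq0 => /eqP ->.
Qed.

(** The face [y o T = 1] through [x0] is a segment whose ends are extreme, lie in M_T and have the
    same [y]. The affine map [c |-> y (S (x0 + c *: v))] vanishes at both ends, hence at 0 between
    them. *)
Lemma supp_null_extreme (V W : normedModType R) (T S : bop V W) :
  has_dim [set: V] 2 -> `|T| = 1 ->
  (forall x y, (norm_attainment T `&` extreme_points (unit_ball V)) x ->
     supp_funs (T x) y -> y (S x) = 0) ->
  supp_null T S.
Proof.
move=> dV T1 TS x0 y [x01 Tx0] [y1 yTx0].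
pose phi : {linear V -> R^o} := y \o T.
have x0B : `|x0| <= 1 by rewrite x01.
have [v [s1 [s2 [phiv /andP[s1_le0 s2_ge0] s1B s2B seg]]]] :=
  level_segment (phi := phi) dV x0B yTx0.
have phile x : `|x| <= 1 -> phi x <= 1.
  move=> x1; rewrite (le_trans (ler_norm _))// bop_le1 ?y1//.
  by rewrite bop_le1 ?T1.
have ends s : s = s1 \/ s = s2 -> `|x0 + s *: v| <= 1 ->
    y (S x0) + s * y (S v) = 0.
  move=> s12 sB.
  have phis : y (T (x0 + s *: v)) = 1.
    have yTv : y (T v) = 0 := phiv.
    by rewrite !linearD !linearZ/= yTv yTx0 scaler0 addr0.
  have yle : `|y| <= 1 by rewrite y1.
  have [Ms Js] := supp_fun_attains T1 sB yle phis.
  have := TS _ _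
    (conj Ms (level_endpoint_extreme phile yTx0 phiv seg s12 sB)) Js.
  by rewrite !linearD !linearZ.
have := ends _ (or_introl erefl) s1B; have := ends _ (or_intror erefl) s2B.
move: (y (S x0) : R) (y (S v) : R) => a c e2 e1.
have [s20|s20] := eqVneq s2 0; first by move: e2; rewrite s20 mul0r addr0.
have s2_gt0 : 0 < s2 by rewrite lt_neqAle eq_sym s20.
have /eqP : (s2 - s1) * a = 0.
  have -> : (s2 - s1) * a = s2 * (a + s1 * c) - s1 * (a + s2 * c) by ring.
  by rewrite e1 e2 !mulr0 subrr.
by rewrite mulf_eq0 gt_eqF ?subr_gt0 ?(le_lt_trans s1_le0)//= => /eqP.
Qed.

(** Pigeonhole principle; all uses of the eight extreme points go through this form. *)
Lemma exists_notin (T : pointedType) (A : set T) (s : seq T) :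
  (`I_8 #<= A)%card -> (size s < 8)%N -> exists2 x, A x & x \notin s.
Proof.
move=> /pcard_leP[f] s8; apply: contrapT => nos.
have sub : {subset map f (iota 0 8) <= s}.
  move=> _ /mapP[i i8 ->]; apply: contrapT => /negP fis; apply: nos.
  exists (f i) => //; apply: funS; move: i8; rewrite mem_iota.
  by [].
have : uniq (map f (iota 0 8)).
  rewrite map_inj_in_uniq ?iota_uniq// => i j; rewrite !mem_iota => i8 j8.
  by apply: inj; rewrite inE.
move=> /uniq_leq_size/(_ sub); rewrite size_map size_iota.
by rewrite leqNgt s8.
Qed.

End extreme.

(** * Independent vectors and functionals in a plane *)

Section plane_vectors.
Context {R : realType}.
Implicit Types V W : normedModType R.

Lemma unit_indep2 V (u v : V) :
  `|u| = 1 -> `|v| = 1 -> u != v -> u != - v -> indep2 u v.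
Proof.
move=> u1 v1 uv uNv; apply: indep2P; first by rewrite -normr_gt0 v1.
move=> k; apply/eqP => uk.
have /eqP : `|k| = 1 by rewrite -u1 uk normrZ v1 mulr1.
rewrite eqr_norml ler01 andbT => /orP[] /eqP k1; move: uk; rewrite k1.
  by rewrite scale1r => /eqP; rewrite (negPf uv).
by rewrite scaleN1r => /eqP; rewrite (negPf uNv).
Qed.

(** A norming functional of [z] is a combination of [y] and [y'], so its value [|z|] is 0. *)
Lemma indep2_separate W (y y' : bop W R^o) (z : W) :
  has_dim [set: W] 2 -> indep2 y y' -> y z = 0 -> y' z = 0 -> z = 0.
Proof.
move=> dW yy' yz y'z; apply/normr0_eq0.
have [f [_ <-]] := norming_functional z dW.
have [a [c ->]] := indep2_span f (has_dim_dual dW) yy'.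
by rewrite bopDE !bopZE yz y'z !scaler0 addr0.
Qed.

(** In coordinates, [z] is the kernel vector of [y'] obtained by swapping its two values with a
    sign. If [y] killed [z] too, then [z = 0] and [y'] would be zero. *)
Lemma indep2_dual_vector W (y y' : bop W R^o) :
  has_dim [set: W] 2 -> indep2 y y' -> exists e, y e = 1 /\ y' e = 0.
Proof.
move=> dW yy'; have [b bb] := (has_dimTP _).1 dW.
pose z := y' (b (lift ord0 ord0)) *: b ord0 - y' (b ord0) *: b (lift ord0 ord0).
have y'z : y' z = 0.
  pose p : R := y' (b ord0); pose q : R := y' (b (lift ord0 ord0)).
  have -> : y' z = q * p - p * q by rewrite linearB !linearZ.
  by rewrite mulrC subrr.
have [yz|yz] := eqVneq (y z) 0; last first.
  exists ((y z)^-1 *: z); rewrite !linearZ/= y'z scaler0.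
  by split=> //; exact: mulVf.
exfalso; have z0 := indep2_separate dW yy' yz y'z.
suff y'0 : y' = 0.
  have [|_ /eqP] := yy' 0 1; first by rewrite scale0r y'0 scaler0 addr0.
  by rewrite oner_eq0.
have z0' : \sum_i (fun i => if i == ord0 then y' (b (lift ord0 ord0)) : R
    else - (y' (b ord0) : R)) i *: b i = 0.
  by rewrite big_ord_recl big_ord1 /= scaleNr.
have cb := proj1 bb _ z0'.
apply: (lin_basis_bop_eq bb) => i; case: (unliftP ord0 i) => [j|] ->.
  by rewrite (ord1 j); exact: (cb ord0).
by have /eqP := cb (lift ord0 ord0); rewrite /= oppr_eq0 => /eqP.
Qed.

Lemma pairing_expand V W (S : bop V W) (u v : V) (y y' : bop W R^o)
    (a b c d : R) :
  (c *: y + d *: y') (S (a *: u + b *: v)) =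
  c * a * y (S u) + c * b * y (S v) + d * a * y' (S u) + d * b * y' (S v) :> R.
Proof.
have yE (f : bop W R^o) :
    f (S (a *: u + b *: v)) = a * f (S u) + b * f (S v) :> R.
  by rewrite !linearD !linearZ.
rewrite bopDE !bopZE !yE -[LHS]/(c * (_ : R) + d * (_ : R)).
by rewrite !mulrDr !mulrA addrA.
Qed.

Lemma bop_indep2_eq V W (u v : V) (S S' : bop V W) :
  has_dim [set: V] 2 -> indep2 u v -> S u = S' u -> S v = S' v -> S = S'.
Proof.
move=> dV uv Su Sv; apply: (lin_basis_bop_eq (indep2_basis dV uv)) => i.
by rewrite /pair_family; case: ifP.
Qed.

End plane_vectors.

(** * Smoothness of operators between planes *)

Section main.
Context {R : realType} (X Y : normedModType R).
Context (dimX : has_dim [set: X] 2) (dimY : has_dim [set: Y] 2).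
Context (T : bop X Y) (normT : `|T| = 1).
Let E := norm_attainment T `&` extreme_points (unit_ball X).

Lemma k_smooth_supp_null d :
  has_dim (supp_null T) d -> k_smooth (4 - d) T.
Proof.
move=> dN; split=> //; apply: (@has_dim_span_annihilator _ _ _ (2 * 2) d).
  exact: has_dim_bop.
by rewrite (annihilator_supp_funs dimX dimY normT).
Qed.

Lemma k_smooth4 : (forall S, supp_null T S -> S = 0) -> k_smooth 4 T.
Proof.
move=> N0; apply: (@k_smooth_supp_null 0); exists (fun=> 0); split.
  by move=> c _ [].
apply/seteqP; split=> [S /N0 -> | _ [c ->]].
  by exists (fun=> 0); rewrite big_ord0.
by move=> x y _ _; rewrite big_ord0 linear0.
Qed.

Lemma k_smooth3 (S0 : bop X Y) : S0 != 0 -> supp_null T S0 ->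
  (forall S, supp_null T S -> exists k, S = k *: S0) -> k_smooth 3 T.
Proof.
move=> S00 NS0 NS; apply: (@k_smooth_supp_null 1); exists (fun=> S0); split.
  move=> c; rewrite big_ord1 => /eqP.
  rewrite scaler_eq0 (negPf S00) orbF => /eqP c0 i.
  by rewrite (ord1 i).
apply/seteqP; split=> [S /NS[k ->]| _ [c ->]].
  by exists (fun=> k); rewrite big_ord1.
by move=> x y Mx Jy; rewrite big_ord1 bopZE linearZ/= (NS0 _ _ Mx Jy) scaler0.
Qed.

Lemma supp_funs_neq0 x : E x -> exists y, supp_funs (T x) y.
Proof.
move=> [[x1 Tx] _]; have [y [y1 yTx]] := norming_functional (T x) dimY.
exists y; have [||||_] := @supp_fun_attains _ _ _ T y x => //.
  by rewrite x1.
by rewrite yTx Tx.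
Qed.

Lemma supp_null_at S x y : supp_null T S -> E x -> supp_funs (T x) y ->
  y (S x) = 0.
Proof. by move=> NS [Mx _]; exact: NS. Qed.

(** Each of the levels 1 and -1 of [y o T] holds at most two extreme points; with at most three in
    [s], no more than seven are excluded. *)
Lemma exists_off_face (y : bop Y R^o) (s : seq X) :
  (`I_8 #<= E)%card -> (size s < 4)%N ->
  exists x, [/\ E x, x \notin s & y (T x) != 1 /\ y (T x) != - 1].
Proof.
move=> cardE s4.
have [p [q pq]] := extreme_level (y \o T) dimX.
have [p' [q' pq']] := extreme_level ((- y) \o T) dimX.
have [|x Ex] := @exists_notin X _ ([:: p; q; p'; q'] ++ s) cardE.
  by rewrite size_cat.
rewrite mem_cat negb_or => /andP[xs4 xs]; exists x; split=> //.
split; apply/eqP => yTx; move: xs4; rewrite !inE.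
  by have [->|->] := pq _ Ex.2 yTx; rewrite eqxx ?orbT.
have NyTx : (- y) (T x) = 1 by rewrite -[LHS]/(- y (T x)) yTx opprK.
by have [->|->] := pq' _ Ex.2 NyTx; rewrite eqxx ?orbT.
Qed.

Lemma off_face_indep2 x x' y y' : supp_funs (T x) y -> supp_funs (T x') y' ->
  y (T x') != 1 -> y (T x') != - 1 -> indep2 y y'.
Proof.
move=> [y1 _] [y'1 y'Tx'] yx' yNx'; apply: unit_indep2 => //.
  by apply: contraNneq yx' => ->; rewrite y'Tx'.
by apply: contraNneq yNx' => ->; apply/eqP; rewrite -[LHS]/(- y' (T x')) y'Tx'.
Qed.

Lemma extreme_indep2 x x' : E x -> E x' -> x' \notin [:: x; - x] -> indep2 x x'.
Proof.
move=> [[x1 _] _] [[x'1 _] _]; rewrite !inE negb_or => /andP[xx' xNx'].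
apply: unit_indep2 => //; first by rewrite eq_sym.
by rewrite eq_sym eqr_oppLR.
Qed.

Context (cardE : (`I_8 #<= E)%card).

(** Two independent support functionals at [T x] force [S x = 0]. Then [S x3] is a nonzero multiple
    of [S x2], so the independent [y2] and [y3] both kill [S x2]. *)
Lemma k_smooth4_nonsmooth x : E x -> ~ smooth (T x) -> k_smooth 4 T.
Proof.
move=> Ex nsm; have [y Jy] := supp_funs_neq0 Ex.
have [y' [Jy' y'y]] : exists y', supp_funs (T x) y' /\ y' != y.
  apply: contrapT => uniq_y; apply: nsm; split.
    by rewrite Ex.1.2.
  exists y; apply/seteqP; split=> [y' Jy'|_ ->//].
  by apply: contrapT => y'y; apply: uniq_y; exists y'; split=> //; exact/eqP.
have yy' : indep2 y' y.
  apply: unit_indep2; rewrite ?Jy.1 ?Jy'.1//; apply/eqP => y'E.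
  have := Jy'.2; rewrite y'E -[(- y) _]/(- y (T x)) Jy.2 => /eqP.
  by rewrite eqNr oner_eq0.
have [x2 Ex2 x2x] := @exists_notin X _ [:: x; - x] cardE isT.
have [y2 Jy2] := supp_funs_neq0 Ex2.
have [x3 [Ex3 x3x [y2x3 y2Nx3]]] := @exists_off_face y2 [:: x; - x] cardE isT.
have [y3 Jy3] := supp_funs_neq0 Ex3.
have y23 := off_face_indep2 Jy2 Jy3 y2x3 y2Nx3.
have xx2 := extreme_indep2 Ex Ex2 x2x.
have xx3 := extreme_indep2 Ex Ex3 x3x.
apply: k_smooth4 => S NS.
have Sx : S x = 0.
  by apply: (indep2_separate dimY yy'); [exact: supp_null_at NS Ex Jy'|
    exact: supp_null_at NS Ex Jy].
apply: (bop_indep2_eq dimX xx2); rewrite ?Sx ?linear0//.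
apply: (indep2_separate dimY y23); first exact: supp_null_at NS Ex2 Jy2.
have [a [b x3E]] := indep2_span x3 dimX xx2.
have b0 : b != 0.
  apply/eqP => b0; have [_ /eqP] : a = 0 /\ - 1 = 0 :> R.
    by apply: xx3; rewrite x3E b0 scale0r addr0 scaleN1r subrr.
  by rewrite oppr_eq0 oner_eq0.
have := supp_null_at NS Ex3 Jy3.
rewrite x3E !linearD !linearZ/= Sx linear0 scaler0 add0r => /eqP.
by rewrite [_ *: _ == 0]mulf_eq0 (negPf b0) => /eqP.
Qed.

(* The independence condition does not force y1 and y3 to be linearly
   independent: if y3 = - y1 or y3 = y1, the coefficients of y2 and y4 are not
   unique and the determinant carries no information. T is 4-smooth in this case
   because y o S = 0 for all S in N, and two more points off the lines
   y o T = 1 and y o T = - 1 force S = 0. *)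
Lemma k_smooth4_parallel x x3 y y3 : E x -> E x3 -> indep2 x x3 ->
  supp_funs (T x) y -> supp_funs (T x3) y3 -> y = y3 \/ y = - y3 ->
  k_smooth 4 T.
Proof.
move=> Ex Ex3 xx3 Jy Jy3 yy3; apply: k_smooth4 => S NS.
have yS v : y (S v) = 0.
  have yx := supp_null_at NS Ex Jy.
  have yx3 : y (S x3) = 0.
    have := supp_null_at NS Ex3 Jy3; case: yy3 => -> // h.
    by rewrite -[LHS]/(- y3 (S x3)) h oppr0.
  have [a [c ->]] := indep2_span v dimX xx3.
  by rewrite !linearD !linearZ/= yx yx3 !scaler0 addr0.
have off x' : E x' -> y (T x') != 1 -> y (T x') != - 1 -> S x' = 0.
  move=> Ex' yx' yNx'; have [y' Jy'] := supp_funs_neq0 Ex'.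
  apply: (indep2_separate dimY (off_face_indep2 Jy Jy' yx' yNx')) => //.
  exact: supp_null_at NS Ex' Jy'.
have [x5 [Ex5 _ [yx5 yNx5]]] := @exists_off_face y [::] cardE isT.
have [x6 [Ex6 x65 [yx6 yNx6]]] := @exists_off_face y [:: x5; - x5] cardE isT.
by apply: (bop_indep2_eq dimX (extreme_indep2 Ex5 Ex6 x65)); rewrite !off.
Qed.

Lemma k_smooth4_independent : independence_condition T -> k_smooth 4 T.
Proof.
move=> [x1 [x2 [x3 [x4 [
  y1 [y2 [y3 [y4 [a [b [c [d [al1 [al2 [be1 [be2]]]]]]]]]]]]]]]].
move=> [xuniq [E1 E2 E3 E4] [J1 J2 J3 J4] [x2E x4E y2E y4E] det].
(* Distinctness enters here: if [x3 = - x1], the unit vector [x2] would be [x1] or [x3]. *)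
have x13 : indep2 x1 x3.
  apply: (extreme_indep2 E1 E3); apply/negP => x3x1.
  have [k x2k] : exists k, x2 = k *: x1.
    move: x3x1; rewrite !inE => /orP[] /eqP x3x1.
      by exists (a + b); rewrite x2E x3x1 scalerDl.
    by exists (a - b); rewrite x2E x3x1 scalerBl scalerN.
  have /eqP : `|k| = 1 by rewrite -E2.1.1 x2k normrZ E1.1.1 mulr1.
  move: xuniq x3x1; rewrite /= !inE !negb_or.
  move=> /and4P[/and3P[x12 x13 _] /andP[x23 _] _ _].
  rewrite eq_sym (negPf x13)/= => /eqP x3x1.
  rewrite eqr_norml ler01 andbT => /orP[] /eqP k1.
    by move: x12; rewrite x2k k1 scale1r eqxx.
  by move: x23; rewrite x2k k1 x3x1 scaleN1r eqxx.
have [yy|yy] := pselect (y1 = y3 \/ y1 = - y3).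
  exact: (k_smooth4_parallel E1 E3 x13 J1 J3 yy).
have y13 : indep2 y1 y3.
  by apply: unit_indep2; rewrite ?J1.1 ?J3.1//; apply/eqP => h; apply: yy;
    [left|right].
apply: k_smooth4 => S NS.
have y1x1 := supp_null_at NS E1 J1; have y3x3 := supp_null_at NS E3 J3.
have := supp_null_at NS E2 J2; have := supp_null_at NS E4 J4.
rewrite y2E y4E x2E x4E !pairing_expand y1x1 y3x3 !mulr0 !add0r !addr0.
have y1x3 := erefl (y1 (S x3)); have y3x1 := erefl (y3 (S x1)).
move: {-2}(y1 (S x3) : R) y1x3 {-2}(y3 (S x1) : R) y3x1 => q qE p pE e4 e2.
(* Cramer's rule: eliminating [q], then [p], from [e2] and [e4] leaves the other unknown times the
   determinant. *)
have p0 : p = 0.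
  apply: (mulfI det); rewrite mulr0.
  transitivity ((be1 * d) * (al1 * b * q + al2 * a * p)
    - (al1 * b) * (be1 * d * q + be2 * c * p)); first by ring.
  by rewrite e2 e4 !mulr0 subrr.
have q0 : q = 0.
  apply: (mulfI det); rewrite mulr0.
  transitivity ((al2 * a) * (be1 * d * q + be2 * c * p)
    - (be2 * c) * (al1 * b * q + al2 * a * p)); first by ring.
  by rewrite e2 e4 !mulr0 subrr.
apply: (bop_indep2_eq dimX x13).
  by apply: (indep2_separate dimY y13) => //; rewrite -pE.
by apply: (indep2_separate dimY y13) => //; rewrite -qE.
Qed.

Lemma smooth_supp_funs_eq (z : Y) y y' :
  smooth z -> supp_funs z y -> supp_funs z y' -> y = y'.
Proof. by move=> [_ [f ->]] -> ->. Qed.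

(** The equation of one further point [x2] is nontrivial, so its solutions are the multiples of one
    operator [S0]. Failure of the condition, with each other [x] as fourth point, says that [S0]
    solves the equation of [x] too. *)
Lemma k_smooth3_dependent :
  (forall x, E x -> smooth (T x)) -> ~ independence_condition T ->
  k_smooth 3 T.
Proof.
move=> smE dep.
have [x1 E1 _] := @exists_notin X _ [::] cardE isT.
have [y1 J1] := supp_funs_neq0 E1.
have [x3 [E3 x31 [y1x3 y1Nx3]]] := @exists_off_face y1 [:: x1; - x1] cardE isT.
have [y3 J3] := supp_funs_neq0 E3.
have y13 := off_face_indep2 J1 J3 y1x3 y1Nx3.
have x13 := extreme_indep2 E1 E3 x31.
have [x2 E2] := @exists_notin X _ [:: x1; - x1; x3; - x3] cardE isT.
rewrite (_ : [:: _; _; _; _] = [:: x1; - x1] ++ [:: x3; - x3])//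
  mem_cat negb_or.
move=> /andP[x21 x23].
have [y2 J2] := supp_funs_neq0 E2.
have [a [b x2E]] := indep2_span x2 dimX x13.
have [al1 [al2 y2E]] := indep2_span y2 (has_dim_dual dimY) y13.
have a0 : a != 0.
  apply/eqP => a0.
  have [|_ /eqP] := extreme_indep2 E3 E2 x23 (a := b) (c := - 1).
    by rewrite x2E a0 scale0r add0r scaleN1r subrr.
  by rewrite oppr_eq0 oner_eq0.
have b0 : b != 0.
  apply/eqP => b0.
  have [|_ /eqP] := extreme_indep2 E1 E2 x21 (a := a) (c := - 1).
    by rewrite x2E b0 scale0r addr0 scaleN1r subrr.
  by rewrite oppr_eq0 oner_eq0.
have al0 : (al1 != 0) || (al2 != 0).
  apply: contraTT isT; rewrite negb_or !negbK => /andP[/eqP al10 /eqP al20].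
  have := J2.1; rewrite y2E al10 al20 !scale0r addr0 normr0 => /eqP.
  by rewrite eq_sym oner_eq0.
have [e1 [y1e1 y3e1]] := indep2_dual_vector dimY y13.
have y31 : indep2 y3 y1 by move=> r s; rewrite addrC => /y13[].
have [e3 [y3e3 y1e3]] := indep2_dual_vector dimY y31.
(* A solution of [al2 * a * p + al1 * b * q = 0], nonzero since [a] and [b] are nonzero and [al1],
   [al2] are not both 0. *)
pose p := al1 * b; pose q := - (al2 * a).
have [S0 [S0x1 S0x3]] := indep2_bop (p *: e3) (q *: e1) dimX x13.
have y1S1 : y1 (S0 x1) = 0 by rewrite S0x1 linearZ/= y1e3 scaler0.
have y3S1 : y3 (S0 x1) = p by rewrite S0x1 linearZ/= y3e3 [_ *: _]mulr1.
have y1S3 : y1 (S0 x3) = q by rewrite S0x3 linearZ/= y1e1 [_ *: _]mulr1.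
have y3S3 : y3 (S0 x3) = 0 by rewrite S0x3 linearZ/= y3e1 scaler0.
apply: (@k_smooth3 S0).
- apply/eqP => S00; have p0 : p = 0 by rewrite -y3S1 S00; exact: linear0.
  have q0 : q = 0 by rewrite -y1S3 S00; exact: linear0.
  move/eqP: p0; rewrite mulf_eq0 (negPf b0) orbF => al10.
  move/eqP: q0; rewrite oppr_eq0 mulf_eq0 (negPf a0) orbF => al20.
  by move: al0; rewrite al10 al20.
- apply: supp_null_extreme => // x y Ex Jy.
  (* The condition asks for distinct points, so the three chosen ones are checked directly;
     smoothness identifies [y] with the chosen functional. *)
  have [xx|] := boolP (x \in [:: x1; x2; x3]).
    move: xx; rewrite !inE => /or3P[] /eqP xx; rewrite xx in Jy *.
    + by rewrite (smooth_supp_funs_eq (smE _ E1) Jy J1).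
    + rewrite (smooth_supp_funs_eq (smE _ E2) Jy J2) y2E x2E pairing_expand.
      rewrite y1S1 y1S3 y3S1 y3S3 /p /q; ring.
    + by rewrite (smooth_supp_funs_eq (smE _ E3) Jy J3).
  rewrite !inE !negb_or => /and3P[xx1 xx2 xx3].
  have [c [d xE]] := indep2_span x dimX x13.
  have [be1 [be2 yE]] := indep2_span y (has_dim_dual dimY) y13.
  rewrite yE xE pairing_expand y1S1 y1S3 y3S1 y3S3.
  apply: contrapT => ne0; apply: dep.
  exists x1, x2, x3, x, y1, y2, y3, y, a, b, c, d, al1, al2, be1, be2.
  split=> //.
    rewrite /= !inE !negb_or !andbT; apply/and3P; split.
    + apply/and3P; split; [|by apply: contraNneq x31 => ->; rewrite mem_head|].
        by apply: contraNneq x21 => ->; rewrite mem_head.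
      by rewrite eq_sym.
    + apply/andP; split; last by rewrite eq_sym.
      by apply: contraNneq x23 => ->; rewrite mem_head.
    + by rewrite eq_sym.
  apply/eqP => det; apply: ne0; rewrite /p /q.
  (* The value [y (S0 x)] is minus the determinant. *)
  transitivity (- (be1 * al2 * a * d - be2 * al1 * b * c)); first by ring.
  by rewrite det oppr0.
- move=> S NS; have := supp_null_at NS E2 J2.
  have Sy1 := supp_null_at NS E1 J1; have Sy3 := supp_null_at NS E3 J3.
  rewrite y2E x2E pairing_expand Sy1 Sy3 !mulr0 !add0r !addr0 => rel.
  suff [k [kp kq]] : exists k : R, y3 (S x1) = k * p /\ y1 (S x3) = k * q.
    exists k; apply: (bop_indep2_eq dimX x13); apply/eqP;
      rewrite -subr_eq0; apply/eqP/(indep2_separate dimY y13);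
      rewrite linearB bopZE linearZ/=.
    + by rewrite Sy1 y1S1 scaler0 subrr.
    + by rewrite y3S1 kp subrr.
    + by rewrite y1S3 kq subrr.
    + by rewrite Sy3 y3S3 scaler0 subrr.
  move: rel; move: (y1 (S x3) : R) (y3 (S x1) : R) => u v rel.
  (* The factor [k] is read off from [p] when [al1] is nonzero; otherwise [p = 0] and it is read off
     from [q]. *)
  have [al10|al10] := eqVneq al1 0.
    have al20 : al2 != 0 by move: al0; rewrite al10 eqxx.
    exists (- u / (al2 * a)); rewrite /p /q al10; split; last first.
      by field; rewrite al20 a0.
    rewrite mul0r mulr0; apply/eqP; move/eqP: rel.
    by rewrite al10 !mul0r add0r !mulf_eq0 (negPf al20) (negPf a0).
  exists (v / (al1 * b)); rewrite /p /q; split.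
    by field; rewrite al10 b0.
  apply: (mulfI (mulf_neq0 al10 b0)).
  transitivity (- (al2 * a * v)); last by field; rewrite al10 b0.
  by apply/eqP; rewrite -addr_eq0 rel.
Qed.

End main.

Theorem theorem3p3 (R : realType) (X Y : completeNormedModType R)
    (dimX : has_dim [set: X] 2) (dimY : has_dim [set: Y] 2)
    (T : bop X Y) (normT : `|T| = 1)
    (cardT : (`I_8 #<= norm_attainment T `&` extreme_points (unit_ball X))%card) :
  ((exists x, (norm_attainment T `&` extreme_points (unit_ball X)) x /\
     ~ smooth (T x)) ->
   k_smooth 4 T) /\
  ((forall x, (norm_attainment T `&` extreme_points (unit_ball X)) x ->
     smooth (T x)) ->
   (independence_condition T -> k_smooth 4 T) /\
   (~ independence_condition T -> k_smooth 3 T)).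
Proof.
split=> [[x [Ex nsm]]|smE].
  exact: (k_smooth4_nonsmooth dimX dimY normT cardT Ex nsm).
split; first exact: k_smooth4_independent.
exact: k_smooth3_dependent.
Qed.
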